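(* If $a,b>0$ satisfy $ab=\frac56$ and $b\in[\frac73,\frac83]$, then the Gabor system $\mathcal{G}(B_2,a,b)=\{e^{2\pi i bm\cdot}B_2(\cdot-ak)\}_{k,m\in\mathbb{Z}}$ is not a frame for $L^2(\mathbb{R})$.
   Context: $B_2=\chi_{[-1/2,1/2]}*\chi_{[-1/2,1/2]}$, i.e. $B_2(x)=\max(1-|x|,0)$. *)

(* Defs.v *)
From HB Require Import structures.
From mathcomp Require Import all_boot all_order all_algebra.
From mathcomp Require Import all_classical all_reals all_analysis.
Set Implicit Arguments. Unset Strict Implicit. Unset Printing Implicit Defensive.
Import Order.TTheory GRing.Theory Num.Theory.
Local Open Scope classical_set_scope.
Local Open Scope ring_scope.

Definition B2 {R : realType} (x : R) : R := Num.max (1 - `|x|) 0.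

(* A complex-valued function f = u + i v on R is represented by its real and
   imaginary parts u v : R -> R.  f lies in L^2(R) iff u and v are Lebesgue
   measurable and square integrable. *)
Definition L2R {R : realType} (u : R -> R) : Prop :=
  measurable_fun [set: R] u /\
  (@lebesgue_measure R).-integrable [set: R] (fun x => ((u x) ^+ 2)%:E).

Definition L2normsq {R : realType} (u v : R -> R) : R :=
  Rintegral (@lebesgue_measure R) [set: R] (fun x => (u x) ^+ 2 + (v x) ^+ 2).

(* Gabor atom g_{k,m}(x) = e^{2 pi i b m x} B2(x - a k).
   <f, g_{k,m}> = \int f(x) conj(g_{k,m}(x)) dx, with real part
   \int (u cos t + v sin t) B2(x - ak) and imaginary part
   \int (v cos t - u sin t) B2(x - ak), where t = 2 pi b m x. *)
Definition gabor_coef_re {R : realType} (a b : R) (u v : R -> R) (k m : int) : R :=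
  Rintegral (@lebesgue_measure R) [set: R]
    (fun x => (u x * cos (2 * pi * b * m%:~R * x) + v x * sin (2 * pi * b * m%:~R * x))
              * B2 (x - a * k%:~R)).

Definition gabor_coef_im {R : realType} (a b : R) (u v : R -> R) (k m : int) : R :=
  Rintegral (@lebesgue_measure R) [set: R]
    (fun x => (v x * cos (2 * pi * b * m%:~R * x) - u x * sin (2 * pi * b * m%:~R * x))
              * B2 (x - a * k%:~R)).

Definition gabor_sum {R : realType} (a b : R) (u v : R -> R) : \bar R :=
  \esum_(p in [set: int * int])
     ((gabor_coef_re a b u v p.1 p.2) ^+ 2 + (gabor_coef_im a b u v p.1 p.2) ^+ 2)%:E.

Definition B2_gabor_frame {R : realType} (a b : R) : Prop :=
  exists A B : R, 0 < A /\ 0 < B /\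
    forall u v : R -> R, L2R u -> L2R v ->
      ((A * L2normsq u v)%:E <= gabor_sum a b u v)%E /\
      (gabor_sum a b u v <= (B * L2normsq u v)%:E)%E.

(* Main.v *)
(** Take f = \sum_n c_n 1_[n/b, n/b + d], with d small.  The exponentials have period 1/b, so
    folding the translates onto [0, d] turns the coefficients of f in row k into those of
    psi_k = 1_[0, d] G_k / B2 in row 0, where G_k(x) = \sum_n c_n B2(x + n/b - a k).  The
    upper frame bound applied to psi_k thus bounds row k by a constant times d sup |G_k|^2.
    For 7/3 <= b <= 8/3 and ab = 5/6, the 5-periodic extension of c = (0, 3, -5, 5, -3)
    satisfies G_k(0) = 0 for all k; cut off after N periods, it gives G_k(0) <> 0 for at most
    24 rows only.  As d -> 0 the Gabor sum is O(d) while ||f||^2 = 68 N d, which contradicts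
    the lower frame bound for N large. *)
Require Import Defs.
From mathcomp Require Import all_boot all_order all_algebra.
From mathcomp Require Import all_classical all_reals all_analysis.
From mathcomp Require Import measurable_realfun ring lra zify.
Import Order.TTheory GRing.Theory Num.Theory.
Import numFieldNormedType.Exports.
Local Open Scope classical_set_scope.
Local Open Scope ring_scope.

(** * Continuity of [B2] and integrals over segments *)

Section Integration.
Context {R : realType}.
Implicit Types (f g h : R -> R) (p q t d : R).
Local Notation mu := (@lebesgue_measure R).

Lemma continuous_maxr f g : continuous f -> continuous g ->
  continuous (fun x => Num.max (f x) (g x)).
Proof.
move=> cf cg.
rewrite (_ : (fun x => _) = (fun x => (f x + g x + `|f x - g x|) / 2)); last first.
  by apply/funext => x; rewrite maxr_absE.
move=> x; apply: cvgMl; apply: cvgD; first by apply: cvgD; [exact: cf|exact: cg].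
by apply: cvg_norm; apply: cvgB; [exact: cf|exact: cg].
Qed.

Lemma continuous_B2 : continuous (@B2 R).
Proof.
apply: continuous_maxr => x; last exact: cvg_cst.
by apply: cvgB; [exact: cvg_cst|exact: norm_continuous].
Qed.

Lemma continuousD1 t : continuous (fun x : R => x + t).
Proof. by move=> x; apply: cvgD; [exact: cvg_id|exact: cvg_cst]. Qed.

Lemma continuous_addr_comp f t : continuous f -> continuous (fun x => f (x + t)).
Proof. by move=> cf x; apply: continuous_comp; [exact: continuousD1|exact: cf]. Qed.

Lemma continuous_B2D t : continuous (fun x : R => B2 (x + t)).
Proof. exact: continuous_addr_comp continuous_B2. Qed.

Lemma continuous_sum (M : nat) (F : nat -> R -> R) :
  (forall n, continuous (F n)) -> continuous (fun x => \sum_(n < M) F n x).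
Proof.
move=> cF; elim: M => [|M IH].
  by under eq_fun do rewrite big_ord0; move=> x; exact: cvg_cst.
under eq_fun do rewrite big_ord_recr.
by move=> x; apply: cvgD; [exact: IH|exact: cF].
Qed.

Lemma mul_indicE I f : (fun x => \1_I x * f x) = f \_ I.
Proof.
by apply/funext => x; rewrite patchE indicE; case: (x \in I);
  rewrite ?mul1r ?mul0r.
Qed.

Lemma integrable_indic_segment p q f : continuous f ->
  mu.-integrable setT (EFin \o (fun x => \1_(`[p, q]%classic) x * f x)).
Proof.
move=> cf; rewrite mul_indicE -restrict_EFin.
apply: (iffLR (integrable_mkcond _ _)); first exact: measurable_itv.
by apply: continuous_compact_integrable;
  [exact: segment_compact|exact: continuous_subspaceT].
Qed.

Lemma Rintegral_indic_segment p q f :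
  Rintegral mu setT (fun x => \1_(`[p, q]%classic) x * f x) =
  Rintegral mu `[p, q]%classic f.
Proof. by rewrite mul_indicE -Rintegral_mkcond. Qed.

Lemma Rintegral_segment_shift d t f : 0 <= d -> continuous f ->
  Rintegral mu `[t, t + d]%classic f =
  Rintegral mu `[0, d]%classic (fun x => f (x + t)).
Proof.
move=> d0 cf; rewrite /Rintegral; congr fine.
have D1 : derive1 (shift t : R -> R) = cst 1.
  apply/funext => z; rewrite derive1E.
  have H : is_derive z 1 (shift t : R -> R) 1 := is_derive_shift z 1 t.
  exact: (derive_val).
have := @integration_by_substitution_increasing R (shift t) f 0 d d0.
rewrite /= add0r (addrC d) => ->.
- by apply: eq_integral => x _; rewrite D1 !fctE mulr1.
- by move=> x y _ _ xy; rewrite ltrD2r.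
- by rewrite D1 => x _; exact: cvg_cst.
- by rewrite D1; exact: is_cvg_cst.
- by rewrite D1; exact: is_cvg_cst.
- split => //.
  + by apply: cvg_at_right_filter; exact: continuousD1.
  + by apply: cvg_at_left_filter; exact: continuousD1.
- exact: continuous_subspaceT.
Qed.

Lemma Rintegral_sum (M : nat) (F : nat -> R -> R) :
  (forall n, mu.-integrable setT (EFin \o F n)) ->
  Rintegral mu setT (fun x => \sum_(n < M) F n x) =
  \sum_(n < M) Rintegral mu setT (F n).
Proof.
move=> iF; rewrite /Rintegral.
under eq_integral do rewrite -sumEFin.
rewrite (@integral_sum _ _ _ mu setT _ _ (fun n : 'I_M => EFin \o F n)) //.
by rewrite sum_fine // => n _; apply: integrable_fin_num; last exact: iF.
Qed.

End Integration.

(** * The step function and the folding of its coefficients *)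

Section Gabor.
Context {R : realType} (a b : R) (c : nat -> R) (M : nat) (d : R).
Local Notation mu := (@lebesgue_measure R).

Definition step (x : R) : R :=
  \sum_(n < M) c n * \1_(`[n%:R / b, n%:R / b + d]%classic) x.

(* row k of the Ron-Shen fiber matrix at x, applied to c *)
Definition fiber (k : int) (x : R) : R :=
  \sum_(n < M) c n * B2 (x + n%:R / b - a * k%:~R).

(* 1 / B2 on [0, 1/2], extended to a continuous positive function. *)
Definition unB2 (x : R) : R := (Num.max (1 - x) (1 / 2))^-1.

(** The function psi_k: dividing the fiber by [B2] compensates for the window that row 0 multiplies
    in again. *)
Definition lift0 (k : int) (x : R) : R :=
  \1_(`[0, d]%classic) x * (fiber k x * unB2 x).

Lemma continuous_fiber k : continuous (fiber k).
Proof.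
apply: (continuous_sum M (fun n x => c n * B2 (x + n%:R / b - a * k%:~R))) => n x.
apply: cvgMr.
have := continuous_B2D (n%:R / b - a * k%:~R) x.
by under eq_fun do rewrite addrA; move=> cB; apply: cB.
Qed.

Lemma unB2_gt0 x : 0 < unB2 x.
Proof. by rewrite invr_gt0 lt_max; apply/orP; right; lra. Qed.

Lemma unB2_le2 x : unB2 x <= 2.
Proof.
rewrite -[leRHS]invrK lef_pV2 ?posrE ?invr_gt0//; last first.
  by rewrite lt_max; apply/orP; right; lra.
by rewrite le_max; apply/orP; right; rewrite div1r.
Qed.

Lemma continuous_unB2 : continuous unB2.
Proof.
move=> x; apply: cvgV; first by rewrite gt_eqF// lt_max; apply/orP; right; lra.
apply: (@continuous_maxr R (fun x => 1 - x) (fun=> 1 / 2)) => y; last exact: cvg_cst.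
by apply: cvgB; [exact: cvg_cst|exact: cvg_id].
Qed.

Lemma unB2K (x : R) : 0 <= x <= 1 / 2 -> unB2 x * B2 x = 1.
Proof.
move=> /andP[x0 xd].
have x1 : 0 <= 1 - x by lra.
have x2 : 1 / 2 <= 1 - x by lra.
have x3 : 0 < 1 - x by lra.
by rewrite /unB2 /B2 ger0_norm// !max_l// mulVf// gt_eqF.
Qed.

(** The shift by [n / b] moves the n-th segment onto [0, d] and leaves [h] unchanged, so the windows
    add up to [fiber k]. The factor [unB2 x * B2 x], equal to 1 on [0, 1/2], then brings in the
    window of row 0. *)
Lemma Rintegral_step_mul (h : R -> R) (k : int) : 0 <= d -> d <= 1 / 2 -> continuous h ->
  (forall (n : nat) x, h (x + n%:R / b) = h x) ->
  Rintegral mu setT (fun x => step x * h x * B2 (x - a * k%:~R)) =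
  Rintegral mu setT (fun x => lift0 k x * h x * B2 (x - a * 0%:~R)).
Proof.
move=> d0 d2 ch hper.
have cB t : continuous (fun x => h x * B2 (x - t)).
  by move=> x; apply: cvgM; [exact: ch|exact: continuous_B2D].
pose F n x := \1_(`[n%:R / b, n%:R / b + d]%classic) x *
  (c n * (h x * B2 (x - a * k%:~R))).
have cF n : continuous (fun x => c n * (h x * B2 (x - a * k%:~R))).
  by move=> x; apply: cvgMr; exact: cB.
transitivity (Rintegral mu setT (fun x => \sum_(n < M) F n x)).
  apply: eq_Rintegral => x _; rewrite /step !mulr_suml; apply: eq_bigr => n _.
  by rewrite /F; ring.
rewrite Rintegral_sum; last by move=> n; exact: integrable_indic_segment.
pose E n x := \1_(`[0, d]%classic) x * (c n * (h x * B2 (x + (n%:R / b - a * k%:~R)))).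
transitivity (\sum_(n < M) Rintegral mu setT (E n)).
  apply: eq_bigr => n _.
  rewrite /F /E !Rintegral_indic_segment Rintegral_segment_shift//.
  by apply: eq_Rintegral => x _; rewrite hper addrA.
rewrite -Rintegral_sum; last first.
  move=> n; apply: integrable_indic_segment => x; apply: cvgMr.
  by apply: cvgM; [exact: ch|exact: continuous_B2D].
apply: eq_Rintegral => x _; rewrite /E -mulr_sumr /lift0 -!mulrA indicE.
have [xd|] := boolP (x \in _); last by rewrite !mul0r.
have {}xd : 0 <= x <= 1 / 2.
  by move: xd; rewrite inE/= in_itv/= => /andP[-> /le_trans->].
rewrite !mul1r mulr0 subr0 (mulrCA (unB2 x)) unB2K// mulr1 mulr_suml.
by apply: eq_bigr => n _; rewrite addrA; ring.
Qed.

End Gabor.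

(** * The Gabor sum as a sum of rows *)

Section GaborSum.
Context {R : realType} (a b : R).
Local Notation mu := (@lebesgue_measure R).

Definition gabor_row (u v : R -> R) (k : int) : \bar R :=
  \esum_(m in [set: int])
     ((gabor_coef_re a b u v k m) ^+ 2 + (gabor_coef_im a b u v k m) ^+ 2)%:E.

Lemma gabor_row_ge0 u v k : (0 <= gabor_row u v k)%E.
Proof. by apply: esum_ge0 => m _; rewrite lee_fin addr_ge0// sqr_ge0. Qed.

Lemma gabor_sum_rows u v :
  gabor_sum a b u v = \esum_(k in [set: int]) gabor_row u v k.
Proof.
rewrite /gabor_sum /gabor_row esum_esum; last first.
  by move=> k m _ _; rewrite lee_fin addr_ge0// sqr_ge0.
by congr esum; apply/seteqP; split.
Qed.

Lemma gabor_row_le u v k : (gabor_row u v k <= gabor_sum a b u v)%E.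
Proof.
rewrite gabor_sum_rows; apply: esum_ge; exists [set k].
  by split=> //; exact: finite_set1.
by rewrite fsbig_set1.
Qed.

(** Rows are nonnegative, so those outside [0..K-1] vanish. The bound [<= 0] is what the upper frame
    bound yields for a zero fiber. *)
Lemma gabor_sum_finite_rows u v (K : nat) (w : nat -> R) :
  (forall k : int, (forall i : nat, (i < K)%N -> k <> i) -> (gabor_row u v k <= 0)%E) ->
  (forall i : nat, (i < K)%N -> (gabor_row u v i <= (w i)%:E)%E) ->
  (gabor_sum a b u v <= (\sum_(i < K) w i)%:E)%E.
Proof.
move=> hout hin.
pose s : seq int := [seq Posz i | i <- iota 0 K].
have us : uniq s by rewrite map_inj_uniq ?iota_uniq// => i j [].
rewrite gabor_sum_rows (_ : \esum_(k in _) _ = \esum_(k in [set` s]) gabor_row u v k).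
  rewrite esum_fset; [|exact: finite_seq|by move=> k _; exact: gabor_row_ge0].
  rewrite -fsbig_seq// big_map -sumEFin -(big_mkord xpredT (fun i => (w i)%:E)).
  rewrite /index_iota subn0 big_seq [leRHS]big_seq; apply: lee_sum => i.
  by rewrite mem_iota add0n => /andP[_]; exact: hin.
rewrite [RHS]esum_mkcond; apply: eq_esum => k _.
case: ifPn => // ks; apply/eqP; rewrite eq_le gabor_row_ge0 andbT; apply: hout.
move=> i iK ki; move: ks; rewrite notin_setE/=; apply.
by rewrite ki map_f// mem_iota.
Qed.

End GaborSum.

(** * Integer periods of cosine and sine *)

Section Periodicity.
Context {R : realType}.

Lemma cosD2piz (x : R) (z : int) : cos (x + 2 * pi * z%:~R) = cos x.
Proof.
have P n (y : R) : cos (y + 2 * pi * n%:R) = cos y.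
  by rewrite -(periodicn (@cosD2pi R) n y); congr (cos _); ring.
case: z => n; first exact: P.
by rewrite -(P n.+1 (x + _)); congr cos; rewrite NegzE mulrNz; ring.
Qed.

Lemma sinD2piz (x : R) (z : int) : sin (x + 2 * pi * z%:~R) = sin x.
Proof.
have P n (y : R) : sin (y + 2 * pi * n%:R) = sin y.
  by rewrite -(periodicn (@sinD2pi R) n y); congr (sin _); ring.
case: z => n; first exact: P.
by rewrite -(P n.+1 (x + _)); congr sin; rewrite NegzE mulrNz; ring.
Qed.

End Periodicity.

(** * Norms of the step function and of psi_k, and the bound on one row *)

Section StepFunctions.
Context {R : realType} (a b : R) (c : nat -> R) (M : nat) (d : R).
Local Notation mu := (@lebesgue_measure R).
Local Notation u := (step b c M d).
Local Notation psi := (lift0 a b c M d).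

Lemma continuous_lin_comp (f : R -> R) (t : R) : continuous f ->
  continuous (fun x => f (t * x)).
Proof.
move=> cf x; apply: continuous_comp; last exact: cf.
by apply: cvgMr; exact: cvg_id.
Qed.

Lemma gabor_coef_re_step k m : 0 < b -> 0 <= d -> d <= 1 / 2 ->
  gabor_coef_re a b u (fun=> 0) k m = gabor_coef_re a b (psi k) (fun=> 0) 0 m.
Proof.
move=> b0 d0 d2.
have := @Rintegral_step_mul R a b c M d
  (fun x => cos (2 * pi * b * m%:~R * x)) k d0 d2.
rewrite /gabor_coef_re.
under [in X in _ -> X]eq_Rintegral do rewrite mul0r addr0.
under [in X in _ -> _ = X]eq_Rintegral do rewrite mul0r addr0.
apply; first by apply: continuous_lin_comp; exact: continuous_cos.
(* Moving x by [n / b] adds 2 pi m n to the argument, a whole number of periods. *)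
move=> n x; rewrite -(cosD2piz (2 * pi * b * m%:~R * x) (m * n%:Z)); congr cos.
have -> : (m * n%:Z)%:~R = m%:~R * n%:R :> R by rewrite intrM.
by field; rewrite gt_eqF.
Qed.

Lemma gabor_coef_im_step k m : 0 < b -> 0 <= d -> d <= 1 / 2 ->
  gabor_coef_im a b u (fun=> 0) k m = gabor_coef_im a b (psi k) (fun=> 0) 0 m.
Proof.
move=> b0 d0 d2.
have := @Rintegral_step_mul R a b c M d
  (fun x => - sin (2 * pi * b * m%:~R * x)) k d0 d2.
rewrite /gabor_coef_im.
under [in X in _ -> X]eq_Rintegral do rewrite mul0r sub0r -mulrN.
under [in X in _ -> _ = X]eq_Rintegral do rewrite mul0r sub0r -mulrN.
apply.
  by move=> x; apply: cvgN; apply: continuous_lin_comp; exact: continuous_sin.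
move=> n x; rewrite -(sinD2piz (2 * pi * b * m%:~R * x) (m * n%:Z)); congr (- sin _).
have -> : (m * n%:Z)%:~R = m%:~R * n%:R :> R by rewrite intrM.
by field; rewrite gt_eqF.
Qed.

(** Row k of the step function equals row 0 of psi_k, and one row is at most the whole sum. This
    lets the upper frame bound control a single row. *)
Lemma gabor_row_step k : 0 < b -> 0 <= d -> d <= 1 / 2 ->
  (gabor_row a b u (fun=> 0%R) k <= gabor_sum a b (psi k) (fun=> 0%R))%E.
Proof.
move=> b0 d0 d2; apply: le_trans (gabor_row_le a b (psi k) (fun=> 0) 0).
apply: le_esum => m _.
by rewrite gabor_coef_re_step// gabor_coef_im_step.
Qed.

Lemma indic_sqr (I : set R) (x : R) : (\1_I x : R) ^+ 2 = \1_I x.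
Proof. by rewrite indicE; case: (x \in I); rewrite ?expr1n ?expr0n. Qed.

Lemma measurable_indic_segment_mul (p q : R) (f : R -> R) : continuous f ->
  measurable_fun setT (fun x => \1_(`[p, q]%classic) x * f x).
Proof.
move=> cf; apply: measurable_funM; first exact: measurable_indic.
exact: continuous_measurable_fun.
Qed.

Lemma L2R0 : L2R (fun=> 0 : R).
Proof.
split; first exact: measurable_cst.
by under eq_fun do rewrite expr0n; exact: integrable0.
Qed.

Lemma continuous_fiber_unB2 k : continuous (fun x => fiber a b c M k x * unB2 x).
Proof.
by move=> x; apply: cvgM; [exact: continuous_fiber|exact: continuous_unB2].
Qed.

Lemma lift0_sqr k x : psi k x ^+ 2 =
  \1_(`[0, d]%classic) x * (fiber a b c M k x * unB2 x) ^+ 2.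
Proof. by rewrite /lift0 exprMn indic_sqr. Qed.

Lemma continuous_sqr (f : R -> R) : continuous f -> continuous (fun x => f x ^+ 2).
Proof.
move=> cf; under eq_fun do rewrite expr2.
by move=> x; apply: cvgM; exact: cf.
Qed.

Lemma L2R_lift0 k : L2R (psi k).
Proof.
split; first by apply: measurable_indic_segment_mul; exact: continuous_fiber_unB2.
under eq_fun do rewrite lift0_sqr.
by apply: integrable_indic_segment; apply: continuous_sqr; exact: continuous_fiber_unB2.
Qed.

Lemma Rintegral_segment_cst (p q r : R) : p <= q ->
  Rintegral mu `[p, q]%classic (fun=> r) = r * (q - p).
Proof.
move=> pq; rewrite Rintegral_cst//; congr (_ * _).
have := lebesgue_measure_itv `[p, q]; rewrite /= lte_fin => E.
transitivity (fine (if p < q then (q%:E - p%:E)%E else 0%E)).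
  by congr fine; exact: E.
case: ltP => //= qp.
by have -> : q = p by [apply/eqP; rewrite eq_le qp pq]; rewrite subrr.
Qed.

(** The factor 4 is the square of the bound [unB2 <= 2]. *)
Lemma L2normsq_lift0 k (s : R) : 0 <= d ->
  (forall x, 0 <= x <= d -> `|fiber a b c M k x| <= s) ->
  L2normsq (psi k) (fun=> 0) <= 4 * s ^+ 2 * d.
Proof.
move=> d0 hs; rewrite /L2normsq.
under eq_Rintegral do rewrite expr0n addr0 lift0_sqr.
rewrite Rintegral_indic_segment -[X in _ <= _ * X]subr0 -Rintegral_segment_cst//.
apply: le_Rintegral => //.
- apply: continuous_compact_integrable; first exact: segment_compact.
  by apply: continuous_subspaceT; apply: continuous_sqr; exact: continuous_fiber_unB2.
- apply: continuous_compact_integrable; first exact: segment_compact.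
  by apply: continuous_subspaceT => x; exact: cvg_cst.
- move=> x; rewrite /= in_itv/= => xd.
  rewrite (_ : 4 * s ^+ 2 = (s * 2) ^+ 2); last by ring.
  have s0 : 0 <= s := le_trans (normr_ge0 _) (hs _ xd).
  rewrite -real_normK ?num_real// ler_sqr ?nnegrE ?mulr_ge0//.
  by rewrite normrM ler_pM ?hs// gtr0_norm ?unB2_gt0// unB2_le2.
Qed.

(** Since [d < 1 / b] the segments are disjoint, so all cross terms vanish. *)
Lemma step_sqr x : 0 < b -> 0 <= d -> d < 1 / b ->
  u x ^+ 2 = \sum_(n < M) \1_(`[n%:R / b, n%:R / b + d]%classic) x * c n ^+ 2.
Proof.
move=> b0 d0 db; rewrite /step.
have [[n xn]|] := pselect (exists n : 'I_M, x \in `[n%:R / b, n%:R / b + d]%classic);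
    last first.
  move=> nx.
  have Z (n : 'I_M) : \1_(`[n%:R / b, n%:R / b + d]%classic) x = 0 :> R.
    by rewrite indicE; case: (boolP (x \in _)) => // xn; case: nx; exists n.
  by rewrite !big1 ?expr0n// => n _; rewrite Z ?mulr0 ?mul0r.
have H (i : 'I_M) : i != n -> (x \in `[i%:R / b, i%:R / b + d]%classic) = false.
  move=> iE; apply/negP => xi; case/negP: iE.
  move: xi xn; rewrite !inE/= !in_itv/= => /andP[i1 i2] /andP[n1 n2].
  have P (p q : 'I_M) : p%:R / b <= q%:R / b + d -> (p <= q)%N.
    move=> pq; rewrite leqNgt; apply/negP => qp.
    have : (q%:R + 1) / b <= p%:R / b :> R.
      by rewrite ler_pM2r ?invr_gt0// natr1 ler_nat.
    by move=> h; have := le_trans h pq; rewrite mulrDl lerD2l leNgt db.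
  by rewrite -val_eqE eqn_leq !P// ?(le_trans i1)// ?(le_trans n1).
rewrite (bigD1 n)//= big1 ?addr0; last by move=> i iE; rewrite indicE H// mulr0.
rewrite [RHS](bigD1 n)//= big1 ?addr0; last by move=> i iE; rewrite indicE H// mul0r.
by rewrite indicE xn mulr1 mul1r.
Qed.

Lemma L2R_step : 0 < b -> 0 <= d -> d < 1 / b -> L2R u.
Proof.
move=> b0 d0 db; split.
  apply: measurable_sum => n.
  by apply: measurable_funM => //; exact: measurable_indic.
under eq_fun do rewrite step_sqr// -sumEFin.
apply: (@integrable_sum _ _ _ mu setT _ _ _ _ (fun n : 'I_M => EFin \o (fun x =>
   \1_(`[n%:R / b, n%:R / b + d]%classic) x * c n ^+ 2))) => // n _.
by apply: integrable_indic_segment => x; exact: cvg_cst.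
Qed.

Lemma L2normsq_step : 0 < b -> 0 <= d -> d < 1 / b ->
  L2normsq u (fun=> 0) = d * \sum_(n < M) c n ^+ 2.
Proof.
move=> b0 d0 db; rewrite /L2normsq.
under eq_Rintegral do rewrite expr0n addr0 step_sqr//.
rewrite (@Rintegral_sum _ _ (fun n x =>
   \1_(`[n%:R / b, n%:R / b + d]%classic) x * c n ^+ 2)); last first.
  by move=> n; apply: integrable_indic_segment => x; exact: cvg_cst.
rewrite mulr_sumr; apply: eq_bigr => n _.
by rewrite Rintegral_indic_segment Rintegral_segment_cst ?lerDl//; ring.
Qed.

Lemma gabor_row_step_le (B s : R) k : 0 < b -> 0 <= d -> d <= 1 / 2 -> 0 < B ->
  (forall u v : R -> R, L2R u -> L2R v ->
     (gabor_sum a b u v <= (B * L2normsq u v)%:E)%E) ->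
  (forall x, 0 <= x <= d -> `|fiber a b c M k x| <= s) ->
  (gabor_row a b u (fun=> 0%R) k <= (4 * B * d * s ^+ 2)%:E)%E.
Proof.
move=> b0 d0 d2 B0 HB hs; apply: (le_trans (gabor_row_step k b0 d0 d2)).
apply: (le_trans (HB _ _ (L2R_lift0 k) L2R0)); rewrite lee_fin.
rewrite (_ : 4 * B * d * s ^+ 2 = B * (4 * s ^+ 2 * d)); last by ring.
by rewrite ler_pM2l// L2normsq_lift0.
Qed.

End StepFunctions.

(** * Finite sums supported in a window of indices *)

Section Window.
Context {R : realType}.

Lemma sum_window (F : nat -> R) (m l M : nat) : (m + l <= M)%N ->
  (forall n, ~~ (m <= n < m + l)%N -> F n = 0) ->
  \sum_(n < M) F n = \sum_(i < l) F (m + i)%N.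
Proof.
move=> mlM F0.
rewrite -(big_mkord xpredT F) (big_cat_nat (n := m))//=; last by lia.
rewrite (big_cat_nat (n := m + l) (m := m))//=; last by lia.
rewrite big_nat big1 ?add0r; last by move=> n; move=> nm; apply: F0; lia.
rewrite [X in _ + X]big_nat [X in _ + X]big1 ?addr0; last first.
  by move=> n nm; apply: F0; lia.
rewrite -{1}(add0n m) big_addn addKn big_mkord.
by apply: eq_bigr => i _; rewrite addnC.
Qed.

Lemma norm_sum_window_le (F : nat -> R) (m l M : nat) (e : R) :
  (forall n, ~~ (m <= n < m + l)%N -> F n = 0) -> (forall n, `|F n| <= e) ->
  `|\sum_(n < M) F n| <= l%:R * e.
Proof.
move=> F0 Fe; apply: (le_trans (ler_norm_sum _ _ _)).
(* Lengthening the sum of absolute values makes the window fit whatever [M] is. *)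
apply: (@le_trans _ _ (\sum_(n < M + (m + l)) `|F n|)).
  by rewrite big_split_ord/= lerDl sumr_ge0.
rewrite (sum_window (fun n => `|F n|) m l) ?leq_addl//; last first.
  by move=> n nm; rewrite F0 ?normr0.
apply: (@le_trans _ _ (\sum_(i < l) e)); first exact: ler_sum.
by rewrite sumr_const card_ord mulr_natl.
Qed.

End Window.

(** * Elementary bounds on [B2] *)

Section Tent.
Context {R : realType}.
Implicit Types x y : R.

Lemma B2_lipschitz x y : `|B2 x - B2 y| <= `|x - y|.
Proof.
have := ler_dist_dist x y; rewrite /B2 !ler_norml => /andP[xy1 xy2].
have := normr_ge0 (x - y).
by case: (lerP (1 - `|x|) 0); case: (lerP (1 - `|y|) 0) => *; apply/andP; split; lra.
Qed.

Lemma B2_eq0 x : 1 <= `|x| -> B2 x = 0.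
Proof. by move=> x1; rewrite /B2 max_r// subr_le0. Qed.

Lemma B2_1Bnorm x : `|x| <= 1 -> B2 x = 1 - `|x|.
Proof. by move=> x1; rewrite /B2 max_l// subr_ge0. Qed.

Lemma B2_ge0_le1 x : 0 <= B2 x <= 1.
Proof.
rewrite /B2 le_max lexx orbT ge_max ler01 andbT /=.
by have := normr_ge0 x; lra.
Qed.

End Tent.

(** * The coefficients and the kernel relation on the grid of step 1/(6b) *)

Section Coefficients.
Context {R : realType}.

(* One period of a vector in the kernel of the fiber matrix at x = 0, see [fiber_period_eq0]. *)
Definition pattern (n : nat) : R := nth 0 [:: 0; 3; -5; 5; -3] (n %% 5).

(** The first period is zeroed so that every row with a nonzero fiber has an index [k >= 0]. Summing
    over [n < 5 * N + 5] then leaves N full periods. *)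
Definition coef (n : nat) : R := if (n < 5)%N then 0 else pattern n.

Lemma patternD5 q n : pattern (5 * q + n) = pattern n.
Proof. by rewrite /pattern mulnC modnMDl. Qed.

Lemma coefE q n : (5 <= n)%N -> coef (5 * q + n) = pattern n.
Proof. by move=> n5; rewrite /coef patternD5 ifF//; lia. Qed.

Lemma norm_pattern_le5 n : `|pattern n| <= 5.
Proof.
rewrite /pattern; have := ltn_pmod n (isT : (0 < 5)%N).
by case: (n %% 5)%N => [|[|[|[|[|m]]]]]//= _;
  rewrite ?normr0 ?normrN ?ger0_norm ?ler_nat.
Qed.

Lemma norm_coef_le5 n : `|coef n| <= 5.
Proof.
by rewrite /coef; case: ifP; rewrite ?normr0// norm_pattern_le5.
Qed.

Lemma sum_coef_sqr N : \sum_(n < 5 * N + 5) coef n ^+ 2 = 68 * N%:R.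
Proof.
elim: N => [|N IH]; first by rewrite !big_ord_recl big_ord0 /coef/=; ring.
have -> : (5 * N.+1 + 5 = (5 * N + 5).+4.+1)%N by lia.
rewrite !big_ord_recr/= IH -!addnS !coefE// /pattern/= mulrS; ring.
Qed.

Context {b : R} (b_itv : 7 / 3 <= b <= 8 / 3).

Let b0 : 0 < b. Proof. by have := b_itv; lra. Qed.

(** Here [b <= 8 / 3] enters, as [6 * b <= 16]: the point is at distance at least 1 from 0. *)
Lemma B2_far (x : R) (t : int) : `|x| * 6 * b + 16 <= `|t|%:~R ->
  B2 (x + t%:~R / (6 * b)) = 0.
Proof.
move=> xt; apply: B2_eq0.
rewrite addrC -(opprK x) (le_trans _ (lerB_dist _ _))// normrN lerBrDr.
rewrite normrM normfV (gtr0_norm (_ : 0 < 6 * b)); last by have := b0; lra.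
rewrite ler_pdivlMr; last by have := b0; lra.
rewrite -intr_norm (le_trans _ xt)//.
have := b_itv.
rewrite mulrDl mul1r mulrA; lra.
Qed.

(** Here [7 / 3 <= b] enters, as [14 <= 6 * b]: the point lies in the support. *)
Lemma B2_near (t : int) : (`|t| <= 14)%N ->
  B2 (t%:~R / (6 * b)) = 1 - `|t|%:R / (6 * b).
Proof.
move=> t14.
have -> : `|t|%:R = `|t%:~R| :> R by rewrite -intr_norm -abszE.
have b1 : `|t%:~R / (6 * b)| = `|t%:~R| / (6 * b).
  rewrite normrM normfV (gtr0_norm (_ : 0 < 6 * b))//; have := b0; lra.
rewrite B2_1Bnorm b1// ler_pdivrMr ?mul1r; last by have := b0; lra.
have : `|t%:~R| <= 14%:R :> R by rewrite -intr_norm -abszE ler_nat.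
by have := b_itv; lra.
Qed.

(* The value |t| = 15 is excluded, as t / (6 b) may then lie on either side of the edge of the
   support; [fiber_period_eq0] only meets it with coefficient 0. *)
Lemma B2_grid (t : int) : (`|t| != 15)%N ->
  B2 (t%:~R / (6 * b)) = if (`|t| <= 14)%N then 1 - `|t|%:R / (6 * b) else 0.
Proof.
move=> t15; case: ifPn => [/B2_near//|t14].
rewrite -[_ / _]add0r; apply: B2_far.
by rewrite normr0 !mul0r add0r -abszE ler_nat; lia.
Qed.

(** Since 6a = 5/b, raising k by 6 and n by 5 preserves the grid points, so six rows suffice. With t
    the grid index, in each row both the sum of the coefficients with |t| <= 14 and their sum
    weighted by |t| vanish, so the relation does not depend on b. *)
Lemma fiber_period_eq0 (r : nat) : (r < 6)%N ->
  \sum_(i < 9) pattern (8 + i) * B2 ((6%:Z * i%:Z - 12 - 5 * r%:Z)%:~R / (6 * b)) = 0.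
Proof.
case: r => [|[|[|[|[|[|r]]]]]]// _; rewrite !big_ord_recr big_ord0/= /pattern/=.
(* Zero coefficients are removed first; this disposes of |t| = 15, to which [B2_grid] does not
   apply. *)
all: rewrite ?mul0r !B2_grid//.
all: repeat match goal with |- context [absz ?t] =>
  let n := eval vm_compute in (absz t) in change (absz t) with n end.
all: by rewrite /=; ring.
Qed.

End Coefficients.

(** * Vanishing and size of the fibers *)

Section Fibers.
Context {R : realType} {a b : R} (ab : a * b = 5 / 6) (b_itv : 7 / 3 <= b <= 8 / 3).
Variable N : nat.

Let b0 : 0 < b. Proof. by have := b_itv; lra. Qed.

Local Notation G := (fiber a b coef (5 * N + 5)).

(** As a = 5/(6b), both lattices lie in one grid of step 1/(6b), and the position relative to the
    support of [B2] is read off an integer. *)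
Lemma grid_point (n : nat) (k : int) :
  n%:R / b - a * k%:~R = (6%:Z * n%:Z - 5 * k)%:~R / (6 * b).
Proof.
have bN0 : b != 0 by rewrite gt_eqF.
have -> : a = 5 / 6 / b by rewrite -ab mulfK.
by rewrite intrD mulrNz !intrM; field.
Qed.

Lemma fiberE k x : G k x = \sum_(n < 5 * N + 5)
  coef n * B2 (x + (6%:Z * n%:Z - 5 * k)%:~R / (6 * b)).
Proof. by apply: eq_bigr => n _; rewrite -addrA grid_point. Qed.

Lemma fiber_outside_eq0 (k : int) x : 0 <= x <= 1 / 2 ->
  (forall i : nat, (i < 6 * N + 12)%N -> k <> i) -> G k x = 0.
Proof.
move=> xd kN; rewrite fiberE big1// => n _.
have [n5|n5] := ltnP n 5; first by rewrite /coef n5 mul0r.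
rewrite (B2_far b_itv) ?mulr0//.
have kN' : (k < 0)%R \/ ((6 * N + 12)%:Z <= k)%R.
  have [|k0] := ltP k 0; [by left|right].
  rewrite leNgt; apply/negP => kl; apply: (kN `|k|%N); lia.
(* [B2_far] asks for 16 plus [x * 6 * b], which is at most 8 for [x <= 1 / 2]. *)
have t24 : (24 <= absz (6%:Z * n%:Z - 5 * k)%R)%N by have := ltn_ord n; lia.
have : 24%:R <= `|6%:Z * n%:Z - 5 * k|%:~R :> R by rewrite -abszE ler_nat.
rewrite (ger0_norm (_ : 0 <= x)); last by move: xd; lra.
have : x * 6 * b <= 1 / 2 * 6 * (8 / 3).
  by have := b_itv; move: xd b0 => *; rewrite ler_pM ?ler_pM//; lra.
lra.
Qed.

Lemma norm_fiber0_le (k : nat) : `|G k 0| <= 45.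
Proof.
rewrite fiberE (_ : 45 = 9%:R * 5); last by ring.
(* For k = 6q + r with r < 6, the condition |6n - 5k| < 16 forces 5q - 2 <= n <= 5q + 6, hence nine
   indices. For q = 0 the truncated subtraction starts the window at 0, which still covers them. *)
apply: (@norm_sum_window_le R (fun n => coef n *
    B2 (0 + (6%:Z * n%:Z - 5 * k%:Z)%:~R / (6 * b))) (5 * (k %/ 6) - 2)) => n.
  move=> nk; rewrite (B2_far b_itv) ?mulr0// normr0 !mul0r add0r -abszE ler_nat.
  by move: nk; lia.
rewrite normrM -[leRHS]mulr1 ler_pM ?norm_coef_le5//.
by rewrite ger0_norm; have /andP[] := B2_ge0_le1 (0 + (6%:Z * n%:Z - 5 * k%:Z)%:~R / (6 * b)).
Qed.

(** For these rows the nine indices lie between 8 and 5N + 1, away from both cuts, so only the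
    periodic pattern is seen and the row reduces to its residue mod 6. *)
Lemma fiber0_interior_eq0 (k : nat) : (12 <= k < 6 * N)%N -> G k 0 = 0.
Proof.
move=> kN; rewrite fiberE.
pose j := (k %/ 6 - 2)%N; pose r := (k %% 6)%N.
have kE : k = (6 * j + 12 + r)%N by rewrite /j /r; lia.
have r6 : (r < 6)%N by rewrite ltn_pmod.
rewrite (@sum_window R (fun n => coef n *
    B2 (0 + (6%:Z * n%:Z - 5 * k%:Z)%:~R / (6 * b))) (5 * j + 8) 9); first last.
- move=> n nj; rewrite (B2_far b_itv) ?mulr0// normr0 !mul0r add0r -abszE ler_nat.
  by move: nj; lia.
- by move: kN; lia.
rewrite -[RHS](fiber_period_eq0 b_itv r r6); apply: eq_bigr => i _.
rewrite -addnA coefE ?add0r//; congr (_ * B2 (_%:~R / _)).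
by rewrite kE; lia.
Qed.

Lemma fiber_lipschitz k x : `|G k x - G k 0| <= (5 * N + 5)%:R * (5 * `|x|).
Proof.
rewrite /fiber -sumrB (le_trans (ler_norm_sum _ _ _))//.
apply: (@le_trans _ _ (\sum_(n < 5 * N + 5) 5 * `|x|)).
  apply: ler_sum => n _; rewrite -mulrBr normrM ler_pM ?norm_coef_le5//.
  by apply: (le_trans (B2_lipschitz _ _)); rewrite le_eqVlt; apply/orP; left; apply/eqP;
    congr `|_|; ring.
by rewrite sumr_const card_ord -(mulr_natl (5 * `|x|)).
Qed.

End Fibers.

(** * Summation over the rows and contradiction with the lower bound *)

Lemma sum_if_interior {R : realType} (N : nat) (f : R -> R) (y z : R) : (2 <= N)%N ->
  \sum_(k < 6 * N + 12) f (if (12 <= k < 6 * N)%N then y else z) =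
  24 * f z + (6 * N - 12)%:R * f y.
Proof.
move=> N2; rewrite -(big_mkord xpredT (fun k => f (if (12 <= k < 6 * N)%N then y else z))).
have N12 : (12 <= 6 * N)%N by lia.
(* Twelve boundary rows at either end surround the 6N - 12 interior ones. *)
rewrite (big_cat_nat (n := 12)) ?(leq_trans N12) ?leq_addr//=.
rewrite (big_cat_nat N12 (leq_addr _ _))/=.
have sum_const (p q : nat) (g : nat -> R) (w : R) :
    (forall k, (p <= k < q)%N -> g k = w) -> \sum_(p <= k < q) g k = (q - p)%:R * w.
  by move=> gw; rewrite (eq_big_nat _ _ gw) sumr_const_nat -(mulr_natl w).
rewrite (sum_const 0%N 12%N _ (f z)); last by move=> k kN; rewrite ifF//; lia.
rewrite (sum_const 12%N (6 * N)%N _ (f y)); last by move=> k ->.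
rewrite (sum_const (6 * N)%N _ _ (f z)); last by move=> k kN; rewrite ifF//; lia.
by rewrite subn0 addKn; ring.
Qed.

Theorem theorem3p7 (R : realType) (a b : R) :
  0 < a -> 0 < b -> a * b = 5 / 6 -> 7 / 3 <= b <= 8 / 3 ->
  ~ B2_gabor_frame a b.
Proof.
move=> a0 b0 ab b_itv [A [B [A0 [B0 frameAB]]]].
have upper u v : L2R u -> L2R v -> (gabor_sum a b u v <= (B * L2normsq u v)%:E)%E.
  by move=> Lu Lv; have [] := frameAB u v Lu Lv.
(* The 24 boundary rows have fibers of size at most 45 + e <= 46; the final 1 bounds the sum of e^2
   over the interior rows. *)
pose C : R := 24 * 46 ^+ 2 + 1.
have C0 : 0 < C by rewrite /C; lra.
have [N N2 N_big] : exists2 N : nat, (2 <= N)%N & 4 * B * C < 68 * A * N%:R.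
  exists (Num.bound (4 * B * C / (68 * A))).+2 => //.
  have : 0 <= 4 * B * C / (68 * A) by rewrite divr_ge0 ?mulr_ge0 ?ltW.
  move=> /archi_boundP; rewrite ltr_pdivrMr ?mulr_gt0// => /lt_trans; apply.
  by rewrite mulrC ltr_pM2l ?mulr_gt0// ltr_nat.
pose t : R := N%:R + 1.
have t1 : 1 <= t by rewrite /t lerDr.
have t0 : 0 < t by lra.
(* Chosen so that the Lipschitz error 25 t d of a fiber on [0, d] is exactly e = 1/(6t). Then e <= 1
   and (6N - 12) e <= 1. *)
pose d := (150 * t ^+ 2)^-1.
have d0 : 0 < d by rewrite invr_gt0 mulr_gt0// exprn_gt0.
have d150 : d <= 150^-1.
  by rewrite lef_pV2 ?posrE ?mulr_gt0 ?exprn_gt0// ler_peMr// exprn_ege1.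
have db : d < 1 / b.
  rewrite ltr_pdivlMr//; apply: (@le_lt_trans _ _ (150^-1 * (8 / 3))); last by lra.
  by rewrite ler_pM//; [exact: ltW|exact: ltW|move: b_itv => /andP[]].
have d2 : d <= 1 / 2 by lra.
pose e : R := (6 * t)^-1.
have e0 : 0 <= e by rewrite invr_ge0 mulr_ge0// ltW.
have e1 : e <= 1 by rewrite invf_le1 ?mulr_gt0//; lra.
have ed : (5 * N + 5)%:R * (5 * d) = e.
  rewrite natrD natrM /d /e; rewrite (_ : 5 * N%:R + 5 = 5 * t); last by rewrite /t; ring.
  by field; rewrite gt_eqF.
have fiber_near k x : 0 <= x <= d ->
    `|fiber a b coef (5 * N + 5) k x| <= `|fiber a b coef (5 * N + 5) k 0| + e.
  move=> /andP[x0 xd].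
  rewrite -lerBlDl (le_trans (lerB_dist _ _))//.
  rewrite (le_trans (fiber_lipschitz _ _ _))// -ed.
  by rewrite ler_wpM2l// ler_wpM2l// ger0_norm.
pose u := step b coef (5 * N + 5) d.
pose w (k : nat) := 4 * B * d * (if (12 <= k < 6 * N)%N then e else 46) ^+ 2.
have sum_le : (gabor_sum a b u (fun=> 0%R) <= (\sum_(k < 6 * N + 12) w k)%:E)%E.
  apply: gabor_sum_finite_rows => k.
    (* Outside the range the fiber vanishes on all of [0, d], so the row bound is used with
       [s = 0]. *)
    move=> kN; have := @gabor_row_step_le R a b coef (5 * N + 5) d B 0 k
      b0 (ltW d0) d2 B0 upper.
    rewrite expr0n mulr0; apply=> x /andP[x0 xd].
    by rewrite (fiber_outside_eq0 ab b_itv)// ?normr0//; apply/andP; split => //; lra.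
  move=> _; apply: (@gabor_row_step_le R a b _ _ _ _ _ _ b0 (ltW d0) d2 B0 upper).
  move=> x xd; apply: (le_trans (fiber_near _ _ xd)).
  case: ifP => [kN|_]; first by rewrite (fiber0_interior_eq0 ab b_itv)// normr0 add0r.
  by have := norm_fiber0_le ab b_itv N k; lra.
have sum_w : \sum_(k < 6 * N + 12) w k <= 4 * B * d * C.
  rewrite -mulr_sumr ler_wpM2l//; first by rewrite !mulr_ge0// ltW.
  rewrite (sum_if_interior _ (fun y => y ^+ 2))//=.
  have : (6 * N - 12)%:R * e ^+ 2 <= 1.
    rewrite expr2 mulrA -[leRHS]mulr1 ler_pM ?mulr_ge0//.
    rewrite /e ler_pdivrMr ?mulr_gt0// mul1r /t natr1 -(natrM _ 6) ler_nat.
    by rewrite (leq_trans (leq_subr _ _))// leq_pmul2l// leqnSn.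
  by rewrite /C lerD2l.
have := (frameAB u (fun=> 0) (L2R_step b coef _ d b0 (ltW d0) db) L2R0).1.
move=> /le_trans /(_ sum_le); rewrite lee_fin => /le_trans /(_ sum_w).
rewrite (L2normsq_step b coef _ d b0 (ltW d0) db) sum_coef_sqr.
rewrite (_ : 4 * B * d * C = d * (4 * B * C)); last by ring.
(* Both sides are proportional to d; cancelling it leaves 68 A N <= 4 B C, against the choice of
   N. *)
by rewrite mulrCA ler_pM2l// mulrCA leNgt mulrA N_big.
Qed.
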